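(* Let $n$ and $k$ be positive integers and let $x$ be an integer with $$0\le x \le \binom{n}{\left\lfloor \frac{n}{2}\right\rfloor + (-1)^k\left\lfloor \frac{k}{2}\right\rfloor}.$$ Let $F=\mathcal{B}(n,k-1)\cup X$, where $X$ consists of exactly $x$ sets from the $k$th middle row $\mathcal{B}(n,k)\setminus\mathcal{B}(n,k-1)$. Then $|F|=x+\Sigma(n,k-1)$, the family $F$ contains exactly $$x\cdot\prod_{i=1}^{k-1}\left(\left\lfloor\frac{n+k}{2}\right\rfloor-i+1\right)$$ copies of $\mathcal{P}_k$, and this is the minimum number of copies of $\mathcal{P}_k$ over all families of $x+\Sigma(n,k-1)$ subsets of $[n]=\{1,\dots,n\}$.
   Context: For a set $S$, $\binom{S}{j}$ denotes the collection of all $j$-element subsets of $S$ (empty if $j<0$ or $j>|S|$), and $\binom{n}{j}=0$ if $j<0$ or $j>n$. For an integer $m\ge 0$, $\mathcal{B}(n,m)$ denotes a family of all subsets of $[n]$ of the $m$ middle sizes, i.e. either $$\mathcal{B}(n,m)=\binom{[n]}{\lfloor (n-m+1)/2\rfloor}\cup\cdots\cup\binom{[n]}{\lfloor (n+m-1)/2\rfloor}$$ or $$\mathcal{B}(n,m)=\binom{[n]}{\lceil (n-m+1)/2\rceil}\cup\cdots\cup\binom{[n]}{\lceil (n+m-1)/2\rceil}.$$ (Depending on the parity of $n$ and $m$, these are one or two different families; they have the same size. For $m=0$ the family is empty.) Where there is a choice for $\mathcal{B}(n,k-1)$ or $\mathcal{B}(n,k)$, any choice may be made; $\mathcal{B}(n,k-1)\subseteq\mathcal{B}(n,k)$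 always holds. $\Sigma(n,m)=|\mathcal{B}(n,m)|$ denotes the common size; in particular $\Sigma(n,0)=0$. $\mathcal{P}_k$ denotes the $k$-element totally ordered set (chain). Families of subsets are ordered by inclusion, and a copy of $\mathcal{P}_k$ in a family is a set of $k$ of its members that is totally ordered by inclusion. An empty product equals $1$. *)

(* Defs.v *)
From mathcomp Require Import all_boot all_order all_algebra zify.

Set Implicit Arguments.
Unset Strict Implicit.
Unset Printing Implicit Defensive.

Import Order.TTheory GRing.Theory Num.Theory.
Local Open Scope ring_scope.

(* The ground set [n] is 'I_n.  Row indices are integers, because the bounds  *)
(* of B(n, m) leave {0, ..., n} when m > n + 1.                               *)

Definition binz (n : nat) (j : int) : nat :=
  if j is Posz i then 'C(n, i) else 0%N.

(* divz rounds towards -oo for a positive divisor. *)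
Definition floor_half (z : int) : int := (z %/ 2)%Z.
Definition ceil_half (z : int) : int := - floor_half (- z).

(* The union of the rows of index a, a + 1, ..., b; empty if b < a. *)
Definition rows (n : nat) (a b : int) : {set {set 'I_n}} :=
  [set A : {set 'I_n} | a <= #|A|%:Z <= b].

Definition Bfloor (n m : nat) : {set {set 'I_n}} :=
  rows n (floor_half (n%:Z - m%:Z + 1)) (floor_half (n%:Z + m%:Z - 1)).

Definition Bceil (n m : nat) : {set {set 'I_n}} :=
  rows n (ceil_half (n%:Z - m%:Z + 1)) (ceil_half (n%:Z + m%:Z - 1)).

Definition is_middle (n m : nat) (B : {set {set 'I_n}}) : Prop :=
  B = Bfloor n m \/ B = Bceil n m.

Definition Sigma (n m : nat) : nat := #|Bfloor n m|.

Lemma is_middle_card (n m : nat) (B : {set {set 'I_n}}) :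
  is_middle m B -> #|B| = Sigma n m.
Proof.
case=> -> //; rewrite /Sigma -(card_imset _ (@setC_inj 'I_n)).
congr #|pred_of_set _|; apply/setP=> A.
rewrite -{1}[A]setCK mem_imset ?inE; last exact: setC_inj.
have := cardsC A; rewrite card_ord => An.
by apply/idP/idP; rewrite /ceil_half /floor_half; lia.
Qed.

(* A copy of the chain P_k in F, as a set of k members of F. *)
Definition is_chain_copy (n k : nat) (F C : {set {set 'I_n}}) : bool :=
  [&& C \subset F, #|C| == k &
      [forall A in C, forall B in C, (A \subset B) || (B \subset A)]].

Definition num_chains (n k : nat) (F : {set {set 'I_n}}) : nat :=
  #|[set C : {set {set 'I_n}} | is_chain_copy k F C]|.

(* Main.v *)
(** Every permutation of [n] encodes a maximal chain of subsets.  Truncate each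
    of them to the levels i, ..., n - i, with weight 'C(n, i) - 'C(n, i - 1), for
    all i <= n / 2: every subset is then covered with total weight n!, so that
    this is a fractional version of a symmetric chain decomposition.  A chain
    with g members in G contains 'C(g, k) >= g - (k - 1) copies of P_k, and a
    truncated chain lies in or crosses the k - 1 middle rows; hence the copies
    of P_k in G have total weight at least n! (#|G| - Sigma n (k - 1)).

    Let t = (n + k) / 2.  A copy of P_k that does not contain both the empty set
    and [n] has weight at most n! / (t (t - 1) ... (t - k + 2)), which gives the
    lower bound when G misses one of these two sets.  Otherwise, remove the
    empty set from G: the copies of P_k through it are the copies of P_(k - 1)
    in the rest, and there are enough of them by induction on k. *)

Require Import Defs.
From mathcomp Require Import all_boot all_order all_algebra all_fingroup zify.

Import Order.TTheory GRing.Theory Num.Theory.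

Set Implicit Arguments.
Unset Strict Implicit.
Unset Printing Implicit Defensive.

(** * Inequalities for factorials and binomial coefficients *)

Lemma leq_fact_mul p q : 0 < p -> 0 < q -> p`! * q`! <= (p + q).-1`!.
Proof.
move=> p_gt0; elim: q => [//|[_ _|q IHq _]]; first by rewrite muln1 addn1.
rewrite factS mulnCA addnS /= addnS factS.
by apply: leq_mul; [lia | have := IHq isT; rewrite addnS].
Qed.

Lemma leq_bin_succ n i : i.*2 < n -> 'C(n, i) <= 'C(n, i.+1).
Proof.
move=> lt_in; rewrite -(@leq_pmul2l i.+1) // mul_bin_left.
by apply: leq_mul => //; lia.
Qed.

Lemma leq_bin_mid n j : 0 < j < n -> n <= 'C(n, j).
Proof.
elim: n j => [|n IHn] [|j] //= lt_jn; rewrite binS.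
case: (ltnP j.+1 n) => [lt_j1n | le_nj].
  have := IHn j.+1 lt_j1n; have : 0 < 'C(n, j) by rewrite bin_gt0; lia.
  lia.
have -> : n = j.+1 by lia.
by rewrite binn -[X in _ + X](@bin_sub j.+1 j) // subSnn bin1.
Qed.

Lemma leq_bin_add g k : 0 < k -> g <= 'C(g, k) + k.-1.
Proof.
case: k => [//|k] _ /=; elim: g => [|g IHg]; first by [].
rewrite binS; case: (leqP k g) => [le_kg | lt_gk]; last by lia.
have : 0 < 'C(g, k) by rewrite bin_gt0.
lia.
Qed.

Lemma ffact_leq m p k : m <= p -> m ^_ k <= p ^_ k.
Proof.
elim: k m p => [|k IHk] [|m] [|p] // le_mp.
by rewrite !ffactSS; apply: leq_mul => //; apply: IHk.
Qed.

(** * Chains of sets and the permutations that stabilize them *)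

Section Chains.

Variable T : finType.
Implicit Types (A B D : {set T}) (C : {set {set T}}) (p : {perm T}).

Definition chain C := [forall A in C, forall B in C, (A \subset B) || (B \subset A)].

Lemma chainP C :
  reflect {in C &, forall A B, (A \subset B) || (B \subset A)} (chain C).
Proof.
apply: (iffP forall_inP) => [h A B inA inB | h A inA].
  exact: (forall_inP (h A inA)).
by apply/forall_inP=> B inB; apply: h.
Qed.

Lemma chain_sub C C' : C' \subset C -> chain C -> chain C'.
Proof.
move=> /subsetP sC /chainP hC; apply/chainP => A B inA inB.
by apply: hC; apply: sC.
Qed.

Lemma chain_card_sub C A B :
  chain C -> A \in C -> B \in C -> #|A| <= #|B| -> A \subset B.
Proof.
move=> /chainP hC inA inB le_AB; case/orP: (hC _ _ inA inB) => // sBA.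
by have /eqP-> : B == A by rewrite eqEcard sBA.
Qed.

Lemma chain_card_inj C : chain C -> {in C &, injective (fun A => #|A|)}.
Proof.
move=> hC A B inA inB /= eqAB; apply/eqP; rewrite eqEcard eqAB leqnn andbT.
by apply: (chain_card_sub hC inA inB); rewrite eqAB.
Qed.

(** Distinct members of a chain have distinct sizes, so a chain has no more members than there are
    available sizes. *)
Lemma chain_size_range C lo hi :
  chain C -> (forall A, A \in C -> lo <= #|A| <= hi) -> #|C| <= hi.+1 - lo.
Proof.
move=> hC hr; rewrite cardE -(size_map (fun A : {set T} => #|A|)).
rewrite -[X in _ <= X](size_iota lo); apply: uniq_leq_size.
  rewrite map_inj_in_uniq ?enum_uniq // => A B; rewrite !mem_enum.
  exact: chain_card_inj.
move=> m /mapP[A]; rewrite mem_enum => /hr hA ->.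
by rewrite mem_iota; lia.
Qed.

Lemma chain_topP C : chain C -> C != set0 ->
  exists2 B, B \in C & forall A, A \in C -> A \subset B.
Proof.
move=> hC /set0Pn[B0 B0C]; exists [arg max_(B > B0 in C) #|B|]; first by case: arg_maxnP.
move=> A inA; case: arg_maxnP => // B inB hB.
by apply: (chain_card_sub hC inA inB); apply: hB.
Qed.

Lemma chain_setC C : chain C -> chain ((@setC T) @: C).
Proof.
move=> /chainP hC; apply/chainP => _ _ /imsetP[A inA ->] /imsetP[B inB ->].
by rewrite !setCS orbC; apply: hC.
Qed.

Lemma card_imset_setC C : #|(@setC T) @: C| = #|C|.
Proof. by rewrite card_imset //; apply: setC_inj. Qed.

Lemma imset_setCK C : (@setC T) @: ((@setC T) @: C) = C.
Proof.
rewrite -imset_comp -[RHS]imset_id; apply: eq_imset => A /=.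
exact: setCK.
Qed.

Lemma mem_imset_setC C A : (A \in (@setC T) @: C) = (~: A \in C).
Proof. by rewrite -{1}[A]setCK mem_imset //; apply: setC_inj. Qed.

(** Members of [C] are stabilized setwise. For a chain of subsets of [D] this is the product of the
    symmetric groups on the blocks between consecutive members. *)
Definition stab_on D C : {set {perm T}} :=
  [set p | perm_on D p & [forall A in C, p \in 'N(A | 'P)%g]].

Lemma card_stab_on0 D : #|stab_on D set0| = #|D|`!.
Proof.
rewrite -card_perm; apply: eq_card => p; rewrite !inE.
rewrite [X in _ && X](_ : _ = true) ?andbT //.
by apply/forall_inP => A; rewrite inE.
Qed.

(* A permutation of D preserving A splits into one of A and one of D :\: A. *)
Lemma card_stab_on_split D A C :
  A \subset D -> (forall A', A' \in C -> A' \subset A) ->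
  #|stab_on D (A |: C)| <= #|stab_on A C| * #|D :\: A|`!.
Proof.
move=> sAD sCA; rewrite -card_perm -[X in _ * X]cardsE -cardsX.
pose f p := (restr_perm A p, restr_perm (D :\: A) p).
have nA p : p \in stab_on D (A |: C) -> p \in 'N(A | 'P)%g.
  by rewrite inE => /andP[_ /forall_inP]; apply; rewrite setU11.
have nDA p : p \in stab_on D (A |: C) -> p \in 'N(D :\: A | 'P)%g.
  move=> /[dup] /nA /astabsP hA; rewrite inE => /andP[pD _].
  apply/astabsP => x; rewrite !inE hA; congr (_ && _) => /=.
  exact: (perm_closed x pD).
have f_inj : {in stab_on D (A |: C) &, injective f}.
  move=> p q hp hq [eqA eqDA]; apply/permP => x.
  case: (boolP (x \in A)) => xA.
    by rewrite -(restr_permE (nA _ hp) xA) eqA (restr_permE (nA _ hq)).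
  case: (boolP (x \in D)) => xD.
    have xDA : x \in D :\: A by rewrite inE xA.
    by rewrite -(restr_permE (nDA _ hp) xDA) eqDA (restr_permE (nDA _ hq)).
  move: hp hq; rewrite !inE => /andP[pD _] /andP[qD _].
  by rewrite (out_perm pD xD) (out_perm qD xD).
rewrite -(card_in_imset f_inj); apply/subset_leq_card/subsetP => _ /imsetP[p hp ->].
apply/setXP; rewrite !inE; split; last exact: restr_perm_on.
rewrite restr_perm_on; apply/forall_inP => A' A'C.
have sA'A := subsetP (sCA _ A'C).
have /astabsP nA' : p \in 'N(A' | 'P)%g.
  by move: hp; rewrite inE => /andP[_ /forall_inP]; apply; rewrite setU1r.
apply/astabsP => x /=; rewrite /aperm; case: (boolP (x \in A)) => xA.
  by rewrite (restr_permE (nA _ hp) xA); apply: nA'.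
by rewrite (out_perm (restr_perm_on A p) xA).
Qed.

(** The chain cuts [D] into [#|C| + 1] nonempty blocks, and the stabilizer has as many elements as
    the product of their factorials. Merging two blocks by [leq_fact_mul] lowers the argument of the
    factorial by one, and [#|C|] mergers are made. *)
Lemma card_stab_on D C : chain C ->
  (forall A, A \in C -> (A != set0) && (A \proper D)) ->
  #|stab_on D C| <= (#|D| - #|C|)`!.
Proof.
have [m] := ubnP #|C|; elim: m D C => // m IHm D C lt_Cm hC hpr.
case: (eqVneq C set0) => [-> | C_n0].
  by rewrite card_stab_on0 cards0 subn0.
have [A inA topA] := chain_topP hC C_n0.
have /andP[A_n0 pAD] := hpr A inA.
have defC : A |: C :\ A = C by rewrite setD1K.
have cC : #|C| = #|C :\ A|.+1 by rewrite (cardsD1 A) inA.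
have hC' : chain (C :\ A) by apply: chain_sub hC; apply: subD1set.
have /leq_trans-> // : #|stab_on D C| <= #|stab_on A (C :\ A)| * #|D :\: A|`!.
  rewrite -[in X in X <= _]defC; apply: card_stab_on_split; first exact: proper_sub.
  by move=> A' /setD1P[_ /topA].
have {}IHm : #|stab_on A (C :\ A)| <= (#|A| - #|C :\ A|)`!.
  apply: IHm => //; first by lia.
  move=> A' /setD1P[nA' A'C]; have /andP[-> _] := hpr A' A'C.
  by rewrite properEneq nA' topA.
(* The members have sizes from 1 to [#|A|]; hence [#|A| - #|C :\ A|] is positive, as [leq_fact_mul]
   requires. *)
have le_CA : #|C| <= #|A|.+1 - 1.
  apply: chain_size_range => // A' A'C; have /andP[A'n0 _] := hpr A' A'C.
  by rewrite card_gt0 A'n0 subset_leq_card ?topA.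
have lt_AD := proper_card pAD; have cD := cardsDS (proper_sub pAD).
apply: leq_trans (leq_mul IHm (leqnn _)) _.
apply: leq_trans (leq_fact_mul _ _) _; [lia | lia | apply: eq_leq; congr _`!; lia].
Qed.

(** Splitting off the top member [B] bounds the stabilizer by [(#|B| - (#|C| - 1))!] times
    [(#|T| - #|B|)!]; the bracket on the left is the quotient of [#|T|!] by this product. *)
Lemma card_stab_top C B :
  chain C -> set0 \notin C -> B \in C -> (forall A, A \in C -> A \subset B) ->
  #|stab_on setT C| * ('C(#|T|, #|B|) * #|B| ^_ #|C|.-1) <= #|T|`!.
Proof.
move=> hC n0C inB topB.
have cC : #|C|.-1 = #|C :\ B| by rewrite (cardsD1 B C) inB.
have le_CB : #|C| <= #|B|.+1 - 1.
  apply: chain_size_range => // A inA.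
  rewrite card_gt0 subset_leq_card ?topB // andbT.
  by apply: contraNneq n0C => <-.
have le_BT : #|B| <= #|T| by apply: max_card.
have h1 : #|stab_on setT C| <= #|stab_on B (C :\ B)| * #|setT :\: B|`!.
  rewrite -{1}(setD1K inB); apply: card_stab_on_split; first exact: subsetT.
  by move=> A /setD1P[_ /topB].
have h2 : #|stab_on B (C :\ B)| <= (#|B| - #|C :\ B|)`!.
  apply: card_stab_on; first by apply: chain_sub hC; apply: subD1set.
  move=> A /setD1P[nA inA]; rewrite properEneq nA topB // !andbT.
  by apply: contraNneq n0C => <-.
have cD : #|setT :\: B| = #|T| - #|B| by rewrite cardsDS ?subsetT // cardsT.
rewrite cD in h1; rewrite cC -(bin_fact le_BT) mulnCA leq_mul2l; apply/orP; right.
rewrite -(@ffact_fact #|B| #|C :\ B|); last by lia.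
rewrite mulnC -mulnA leq_mul2l; apply/orP; right.
by apply: leq_trans h1 _; rewrite leq_mul2r h2 orbT.
Qed.

Lemma stab_on_setC C : stab_on setT ((@setC T) @: C) = stab_on setT C.
Proof.
apply/setP => p; rewrite !inE; congr (_ && _).
apply/forall_inP/forall_inP => h A inA.
  by rewrite -astabsC; apply: h; apply: imset_f.
by rewrite -astabsC; apply: h; rewrite -mem_imset_setC.
Qed.

Lemma card_stab_bot C A :
  chain C -> setT \notin C -> A \in C -> (forall B, B \in C -> A \subset B) ->
  #|stab_on setT C| * ('C(#|T|, #|A|) * (#|T| - #|A|) ^_ #|C|.-1) <= #|T|`!.
Proof.
move=> hC nTC inA botA.
have := @card_stab_top ((@setC T) @: C) (~: A) (chain_setC hC).
rewrite !mem_imset_setC setC0 setCK stab_on_setC card_imset_setC.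
have -> : #|~: A| = #|T| - #|A| by rewrite -(cardsC A) addKn.
rewrite bin_sub ?max_card //; apply=> // B; rewrite mem_imset_setC => /botA.
by rewrite -setCS setCK.
Qed.

End Chains.

(** * Maximal chains encoded by permutations, and their weighted truncations *)

Section Flags.

Variable n : nat.
Implicit Types (A B : {set 'I_n}) (C G : {set {set 'I_n}}) (s : 'S_n).

Lemma card_set_ord A : #|A| <= n.
Proof. by rewrite -[X in _ <= X]card_ord max_card. Qed.

(* A permutation encodes the maximal chain of the sets [set x | s x < j]. *)
Definition in_flag s A := [forall x, (x \in A) == (s x < #|A|)].

Lemma in_flagP s A : reflect (forall x, (x \in A) = (s x < #|A|)) (in_flag s A).
Proof. by apply: (iffP forallP) => h x; apply/eqP. Qed.

Lemma in_flag_sub s A B :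
  in_flag s A -> in_flag s B -> #|A| <= #|B| -> A \subset B.
Proof.
move=> /in_flagP hA /in_flagP hB le_AB; apply/subsetP => x.
by rewrite hA hB => /leq_trans->.
Qed.

Lemma card_flag s j : j <= n -> #|[set x | s x < j]| = j.
Proof.
move=> le_jn; rewrite -[LHS](card_imset _ (@perm_inj _ s)).
have w_inj : injective (widen_ord le_jn) by move=> i i' /(congr1 val)/= /val_inj.
rewrite -[RHS]card_ord -[RHS](card_imset _ w_inj).
apply: eq_card => y; apply/imsetP/imsetP => [[x] | [i _ ->]].
  by rewrite inE => lt_xj ->; exists (Ordinal lt_xj) => //; apply: val_inj.
exists ((s^-1)%g (widen_ord le_jn i)); last by rewrite permKV.
by rewrite inE permKV /=.
Qed.

Lemma in_flag_card s j : j <= n -> in_flag s [set x | s x < j].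
Proof. by move=> le_jn; apply/in_flagP => x; rewrite card_flag // inE. Qed.

Lemma in_flag_eq s A : in_flag s A -> A = [set x | s x < #|A|].
Proof. by move=> /in_flagP hA; apply/setP => x; rewrite inE hA. Qed.

Definition flags C : {set 'S_n} := [set s | [forall A in C, in_flag s A]].

(** If [s0] has all of [C] in its flag, then [s * s0^-1] stabilizes every member of [C] for each
    other such [s], and this map is injective. *)
Lemma card_flags_stab C : #|flags C| <= #|stab_on setT C|.
Proof.
case: (set_0Vmem (flags C)) => [-> | [s0]]; first by rewrite cards0.
rewrite inE => /forall_inP h0.
rewrite -(card_imset _ (mulIg (s0^-1)%g)); apply/subset_leq_card/subsetP.
move=> _ /imsetP[s + ->]; rewrite !inE => /forall_inP hs.
apply/andP; split; first by apply/subsetP => x; rewrite inE.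
apply/forall_inP => A inA; apply/astabsP => x /=.
rewrite /aperm (in_flagP _ _ (h0 A inA)) permM permKV.
by rewrite -(in_flagP _ _ (hs A inA)).
Qed.

(** The stabilizer gives the upper bound for every set of size [a]. Each flag has exactly one set of
    size [a], so the counts over these sets add up to [n!], which is also the sum of the upper
    bounds; hence all of them are attained. *)
Lemma card_flags1 A : #|flags [set A]| = #|A|`! * (n - #|A|)`!.
Proof.
pose a := #|A|; have le_an : a <= n by apply: card_set_ord.
have ub B : #|B| == a -> #|flags [set B]| <= a`! * (n - a)`!.
  move=> /eqP eBa; apply: leq_trans (card_flags_stab _) _.
  rewrite -[[set B]]setU0.
  apply: leq_trans (@card_stab_on_split _ _ _ _ (subsetT B) _) _.
    by move=> A'; rewrite inE.
  by rewrite card_stab_on0 cardsDS ?subsetT // cardsT card_ord eBa.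
have tot : \sum_(B : {set 'I_n} | #|B| == a) #|flags [set B]| = n`!.
  transitivity (\sum_(s : 'S_n) 1); last first.
    rewrite sum1_card -(card_Sn n) -cardsT; apply: eq_card => s.
    by rewrite !inE.
  under eq_bigr do rewrite -sum1_card big_mkcond.
  rewrite exchange_big /=; apply: eq_bigr => s _.
  rewrite (bigD1 [set x | s x < a]) ?card_flag //= big1 ?addn0.
    rewrite inE; case: forall_inP => // -[] B /set1P->.
    exact: in_flag_card.
  move=> B /andP[/eqP eBa neB]; rewrite inE; case: forall_inP => // /(_ B (set11 B)).
  by move=> /in_flag_eq defB; rewrite eBa in defB; rewrite defB eqxx in neB.
apply/eqP; rewrite eqn_leq ub //=.
have : \sum_(B : {set 'I_n} | #|B| == a) a`! * (n - a)`! = n`!.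
  rewrite sum_nat_const -(bin_fact le_an); congr (_ * _).
  by rewrite -[in RHS](card_ord n) -card_draws cardsE.
rewrite -tot (bigD1 A) //= [X in _ = X](bigD1 A) //= => e.
rewrite -(leq_add2r (\sum_(B : {set 'I_n} | (#|B| == a) && (B != A)) #|flags [set B]|)) -e.
rewrite leq_add2l; apply: leq_sum => B /andP[eB _]; exact: ub.
Qed.

(** For [i <= n / 2], the number of chains that start at level [i] in a symmetric chain
    decomposition. *)
Definition weight i := if i is j.+1 then 'C(n, i) - 'C(n, j) else 1.

Lemma sum_weight m : m.*2 <= n -> \sum_(i < m.+1) weight i = 'C(n, m).
Proof.
elim: m => [|m IHm] le_mn; first by rewrite big_ord1 /= bin0.
rewrite big_ord_recr /= IHm; last by lia.
by rewrite addnC subnK // leq_bin_succ //; lia.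
Qed.

(** The ranges that contain [a] are those with [i <= minn a (n - a)], and the weights telescope. *)
Lemma sum_weight_range a : a <= n ->
  \sum_(i < n./2.+1) weight i * (i <= a <= n - i) = 'C(n, a).
Proof.
move=> le_an; pose m := minn a (n - a).
have -> : 'C(n, a) = 'C(n, m).
  by rewrite /m; case: leqP => // _; rewrite bin_sub.
rewrite -sum_weight; last by rewrite /m; lia.
rewrite (big_ord_widen n./2.+1); last by rewrite /m; lia.
rewrite [RHS]big_mkcond /=; apply: eq_bigr => i _.
have := ltn_ord i; rewrite /m; case: ifP; case: andP => //; rewrite ?muln1 ?muln0 //; lia.
Qed.

Definition truncate G s i := [set A in G | in_flag s A & i <= #|A| <= n - i].

Lemma in_truncate G s i A :
  (A \in truncate G s i) = [&& A \in G, in_flag s A & i <= #|A| <= n - i].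
Proof. by rewrite inE. Qed.

Lemma card_truncate G s i :
  #|truncate G s i| = \sum_(A in G) in_flag s A * (i <= #|A| <= n - i).
Proof.
rewrite -sum1_card [LHS]big_mkcond [RHS]big_mkcond /=; apply: eq_bigr => A _.
by rewrite inE; case: (A \in G); case: in_flag; case: (_ <= _ <= _).
Qed.

(* The truncated flags, weighted, cover every set with the same multiplicity:
   this is a fractional symmetric chain decomposition of the Boolean lattice. *)
Lemma sum_truncate G :
  \sum_(s : 'S_n) \sum_(i < n./2.+1) weight i * #|truncate G s i| = n`! * #|G|.
Proof.
transitivity (\sum_(A in G) n`!); last by rewrite sum_nat_const mulnC.
transitivity (\sum_(A in G) \sum_(s : 'S_n) \sum_(i < n./2.+1)
    in_flag s A * (weight i * (i <= #|A| <= n - i))).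
  rewrite [RHS]exchange_big /=; apply: eq_bigr => s _.
  rewrite [RHS]exchange_big /=; apply: eq_bigr => i _.
  rewrite card_truncate big_distrr /=; apply: eq_bigr => A _.
  exact: mulnCA.
apply: eq_bigr => A _; have le_An : #|A| <= n by apply: card_set_ord.
under eq_bigr do rewrite -big_distrr /= sum_weight_range //.
rewrite -big_distrl /= -(bin_fact le_An) -card_flags1 mulnC; congr (_ * _).
rewrite -sum1_card [RHS]big_mkcond; apply: eq_bigr => s _; rewrite inE.
case: (boolP (in_flag s A)) => hA; case: forall_inP => //.
  by case=> B /set1P->.
by move=> /(_ A (set11 A)); rewrite (negPf hA).
Qed.

Lemma truncate_chain G s i : chain (truncate G s i).
Proof.
apply/chainP => A B; rewrite !inE => /and3P[_ hA _] /and3P[_ hB _].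
by case: (leqP #|A| #|B|) => [|/ltnW] /(@in_flag_sub s)-> //; rewrite orbT.
Qed.

Lemma in_Bfloor k A : 0 < k <= n.+1 ->
  (A \in Bfloor n k.-1) = ((n.+2 - k)./2 <= #|A| < (n + k)./2).
Proof.
by move=> hk; rewrite inE /floor_half; apply/idP/idP; lia.
Qed.

(* A truncated flag is either contained in the k - 1 middle rows or meets all
   of them. *)
Lemma truncate_middle G s i k : 0 < k <= n.+1 ->
  #|truncate G s i| <= 'C(#|truncate G s i|, k) + #|truncate (Bfloor n k.-1) s i|.
Proof.
move=> hk; have k_gt0 : 0 < k by case/andP: hk.
case: (boolP (((n.+2 - k)./2 <= i) && (n - i < (n + k)./2))) => hi.
  apply: leq_trans (leq_addl _ _); apply/subset_leq_card/subsetP => A.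
  rewrite !in_truncate => /and3P[_ -> hA]; rewrite hA in_Bfloor //=.
  case/andP: hi => lo_i i_hi; case/andP: hA => iA Ai.
  by rewrite (leq_trans lo_i iA) (leq_ltn_trans Ai i_hi).
apply: leq_trans (leq_bin_add _ k_gt0) _; rewrite leq_add2l.
(* One set of the flag for each of the [k - 1] middle rows. The range from [i] to [n - i] is
   symmetric, so once it sticks out of these rows on one side it contains all of them. *)
pose lev (j : 'I_k.-1) := [set x | s x < (n.+2 - k)./2 + j].
have lev_n (j : 'I_k.-1) : (n.+2 - k)./2 + j <= n by have := ltn_ord j; lia.
have lev_inj : injective lev.
  move=> j j' /(congr1 (fun A : {set 'I_n} => #|A|)).
  by rewrite !card_flag // => /addnI/val_inj.
rewrite -[k.-1 in X in X <= _]card_ord -(card_imset _ lev_inj).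
apply/subset_leq_card/subsetP => _ /imsetP[j _ ->].
rewrite in_truncate in_Bfloor // card_flag // in_flag_card //=.
by have := ltn_ord j; lia.
Qed.

Lemma num_chainsE k G :
  num_chains k G = #|[set C : {set {set 'I_n}} | [&& C \subset G, #|C| == k & chain C]]|.
Proof. by []. Qed.

(** Double counting: the binomial coefficient counts the copies of P_k inside a truncated flag. A
    copy [C] lies in [#|flags C|] flags, and the truncations that retain all of [C] retain any
    chosen member [A], so their total weight is at most ['C(n, #|A|)]. *)
Lemma sum_bin_truncate_le k G M :
  (forall C, C \subset G -> #|C| = k -> chain C ->
     exists2 A, A \in C & #|flags C| * 'C(n, #|A|) * M <= n`!) ->
  (\sum_(s : 'S_n) \sum_(i < n./2.+1) weight i * 'C(#|truncate G s i|, k)) * M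
    <= num_chains k G * n`!.
Proof.
move=> hM; rewrite num_chainsE; set Ch := [set C | _].
pose E s i C := (s \in flags C) * (weight i * [forall A in C, i <= #|A| <= n - i]).
have bound s i : weight i * 'C(#|truncate G s i|, k) <= \sum_(C in Ch) E s i C.
  rewrite -cards_draws -sum1_card big_distrr /= big_mkcond [X in _ <= X]big_mkcond.
  apply: leq_sum => C _; rewrite inE; case: ifP => // /andP[sCt cC].
  have -> : C \in Ch.
    rewrite inE cC /= (chain_sub sCt (truncate_chain _ _ _)) andbT.
    by apply/subsetP => A /(subsetP sCt); rewrite inE => /andP[].
  rewrite muln1 /E [in X in X * _]inE.
  have -> : [forall A in C, in_flag s A].
    by apply/forall_inP => A /(subsetP sCt); rewrite inE => /and3P[].
  have -> : [forall A in C, i <= #|A| <= n - i].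
    by apply/forall_inP => A /(subsetP sCt); rewrite inE => /and3P[].
  by rewrite mul1n muln1.
have {}bound : \sum_(s : 'S_n) \sum_(i < n./2.+1) weight i * 'C(#|truncate G s i|, k)
    <= \sum_(C in Ch) \sum_(s : 'S_n) \sum_(i < n./2.+1) E s i C.
  rewrite [X in _ <= X]exchange_big /=; apply: leq_sum => s _.
  rewrite [X in _ <= X]exchange_big /=; apply: leq_sum => i _.
  exact: bound.
apply: leq_trans (leq_mul bound (leqnn M)) _.
rewrite big_distrl /= -sum_nat_const; apply: leq_sum => C.
rewrite inE => /and3P[sCG /eqP cC hC]; have [A inA] := hM C sCG cC hC.
apply: leq_trans; rewrite leq_mul2r; apply/orP; right.
rewrite -(@sum_weight_range #|A|) ?card_set_ord //.
rewrite -sum1_card big_distrl /= [X in _ <= X]big_mkcond /=.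
apply: leq_sum => s _; rewrite /E; case: (s \in flags C); last by rewrite big1.
rewrite mul1n; apply: leq_sum => i _; rewrite mul1n leq_mul2l; apply/orP; right.
by case: forall_inP => // /(_ A inA) ->.
Qed.

(** * The lower bound for arbitrary families *)

Lemma num_chains_ge_missing0T k G : 0 < k <= n.+1 ->
  (set0 \notin G) || (setT \notin G) ->
  (#|G| - Sigma n k.-1) * ((n + k)./2 ^_ k.-1) <= num_chains k G.
Proof.
move=> hk n0T; have k_gt0 : 0 < k by case/andP: hk.
have le_tn : (n + k)./2 <= n by lia.
set M := _ ^_ _.
have n0 : 0 < n`! by apply: fact_gt0.
rewrite -(leq_pmul2r n0).
have ub : (\sum_(s : 'S_n) \sum_(i < n./2.+1)
    weight i * 'C(#|truncate G s i|, k)) * M <= num_chains k G * n`!.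
  apply: sum_bin_truncate_le => // C sCG cC hC.
  have C_n0 : C != set0 by rewrite -card_gt0 cC.
  have [B inB topB] := chain_topP hC C_n0.
  have [A inA botA] : exists2 A, A \in C & forall B, B \in C -> A \subset B.
    have [|A'] := @chain_topP _ ((@setC _) @: C) (chain_setC hC).
      by rewrite -card_gt0 card_imset_setC cC.
    rewrite mem_imset_setC => inA' topA'; exists (~: A') => // B' inB'.
    by rewrite -[B']setCK setCS; apply: topA'; rewrite mem_imset_setC setCK.
  have le_k : k <= #|B|.+1 - #|A|.
    rewrite -cC; apply: chain_size_range => // D inD.
    by rewrite !subset_leq_card ?topB ?botA.
  have le_Bn : #|B| <= n by apply: card_set_ord.
  have top_case : set0 \notin C -> (n + k)./2 <= #|B| ->
      exists2 A, A \in C & #|flags C| * 'C(n, #|A|) * M <= n`!.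
    move=> n0C le_tB; exists B => //; have := card_stab_top hC n0C inB topB.
    rewrite card_ord cC; apply: leq_trans; rewrite -mulnA.
    apply: leq_mul; first exact: card_flags_stab.
    by rewrite leq_mul2l ffact_leq ?orbT.
  have bot_case : setT \notin C -> (n + k)./2 <= n - #|A| ->
      exists2 A, A \in C & #|flags C| * 'C(n, #|A|) * M <= n`!.
    move=> nTC le_tA; exists A => //; have := card_stab_bot hC nTC inA botA.
    rewrite card_ord cC; apply: leq_trans; rewrite -mulnA.
    apply: leq_mul; first exact: card_flags_stab.
    by rewrite leq_mul2l ffact_leq ?orbT.
  case: (boolP (set0 \in C)) => h0.
    apply: bot_case.
      apply/negP => /(subsetP sCG) hT; have := subsetP sCG _ h0.
      by move=> h0G; rewrite h0G hT in n0T.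
    have /eqP-> : A == set0 by rewrite -subset0 botA.
    by rewrite cards0 subn0.
  case: (boolP (setT \in C)) => hT.
    apply: top_case => //; have /eqP-> : B == setT by rewrite eqEsubset subsetT topB.
    by rewrite cardsT card_ord.
  (* With t = [(n + k)./2], the [k] members force [#|A| <= #|B| - k + 1]. If [#|B| < t], then
     [n - #|A| >= n + k - t >= t]. *)
  case: (leqP (n + k)./2 #|B|) => leB; first exact: top_case.
  by apply: bot_case => //; clear -hk le_k le_Bn leB; lia.
apply: leq_trans ub; rewrite mulnAC leq_mul2r; apply/orP; right.
rewrite mulnBl -![_ * n`!]mulnC /Sigma -!sum_truncate leq_subLR addnC -big_split.
apply: leq_sum => s _; rewrite -big_split; apply: leq_sum => i _ /=.
by rewrite -mulnDr leq_mul2l truncate_middle ?orbT.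
Qed.

(** Adding the empty set to a copy of P_k yields a copy of P_(k+1), distinct from those that avoid
    the empty set. *)
Lemma num_chains_D1 k G : set0 \in G ->
  num_chains k.+1 (G :\ set0) + num_chains k (G :\ set0) <= num_chains k.+1 G.
Proof.
move=> inG; rewrite !num_chainsE.
set X1 := [set C | _]; set X2 := [set C | _]; set X := [set C | _].
have inj : {in X2 &, injective (fun C => set0 |: C)}.
  have n0 C : C \in X2 -> set0 \notin C.
    rewrite inE => /and3P[/subsetP sC _ _]; apply/negP => /sC.
    by rewrite !inE eqxx.
  move=> C C' /n0 hC /n0 hC' e.
  by rewrite -(setU1K hC) e setU1K.
rewrite -(card_in_imset inj) -cardsUI [X in _ + #|pred_of_set X|](_ : _ = set0).
  rewrite cards0 addn0; apply/subset_leq_card; rewrite subUset; apply/andP; split.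
    apply/subsetP => C; rewrite !inE => /and3P[sC -> ->].
    by rewrite (subset_trans sC) ?subD1set.
  apply/subsetP => _ /imsetP[C + ->]; rewrite !inE => /and3P[sC /eqP cC /chainP hC].
  apply/and3P; split.
  - by rewrite subUset sub1set inG (subset_trans sC) ?subD1set.
  - rewrite cardsU1 cC; case: (boolP (set0 \in C)) => // /(subsetP sC).
    by rewrite !inE eqxx.
  - apply/chainP => A B /setU1P[->|inA] /setU1P[->|inB]; rewrite ?sub0set ?orbT //.
    exact: hC.
apply/setP => C; rewrite !inE; apply/negP => /andP[/and3P[sC _ _] /imsetP[C' _ eC]].
have : set0 \in C by rewrite eC setU11.
by move/(subsetP sC); rewrite !inE eqxx.
Qed.

Lemma card_row j : #|[set A : {set 'I_n} | #|A| == j]| = 'C(n, j).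
Proof. by rewrite card_draws card_ord. Qed.

Lemma Sigma_step k : 0 < k <= n ->
  Sigma n k.-1 + (if k == n then 1 else n) <= Sigma n k.
Proof.
(* [j] is the row that [Bfloor n k] adds to [Bfloor n k.-1]: at the top if [n + k] is odd, else at
   the bottom. For [k = n] it is row 0, with one set. *)
move=> hk; pose j := if odd (n + k) then (n + k)./2 else (n.+1 - k)./2.
have hj : j <= n by rewrite /j; case: ifP; lia.
have hC : (if k == n then 1 else n) <= 'C(n, j).
  case: eqP => [e | ne]; first by rewrite bin_gt0.
  by apply: leq_bin_mid; rewrite /j; case: ifP; lia.
apply: leq_trans (_ : Sigma n k.-1 + 'C(n, j) <= _); first by rewrite leq_add2l.
rewrite /Sigma -card_row -cardsUI [X in _ + #|pred_of_set X|](_ : _ = set0).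
  rewrite cards0 addn0; apply/subset_leq_card/subsetP => A.
  have hk1 : 0 < k <= n.+1 by lia.
  have hk2 : 0 < k.+1 <= n.+1 by lia.
  have /= inBk := @in_Bfloor k.+1 A hk2.
  rewrite in_setU in_Bfloor // inBk inE; move: #|A| => a.
  by rewrite /j; case: ifP; lia.
apply/setP => A; rewrite in_setI in_set0 in_Bfloor ?inE; last by lia.
by move: #|A| => a; rewrite /j; case: ifP; lia.
Qed.

Lemma num_chains_ge k G : 0 < k <= n.+1 ->
  (#|G| - Sigma n k.-1) * ((n + k)./2 ^_ k.-1) <= num_chains k G.
Proof.
elim: k G => [//|k IHk] G hk.
case: (boolP ((set0 \notin G) || (setT \notin G))) => [|]; first exact: num_chains_ge_missing0T.
rewrite negb_or !negbK => /andP[G0 GT].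
case: (posnP k) => [->|k_gt0].
  rewrite ffactn0 muln1; apply: leq_trans (leq_subr _ _) _.
  rewrite -(card_imset _ (@set1_inj _)) num_chainsE.
  apply/subset_leq_card/subsetP => _ /imsetP[A inA ->]; rewrite inE.
  rewrite sub1set inA cards1 /=; apply/chainP => B B' /set1P-> /set1P->.
  by rewrite subxx.
case: (leqP #|G| (Sigma n k)) => [le_GS | lt_SG].
  by move: le_GS; rewrite -subn_eq0 => /eqP->.
apply: leq_trans (num_chains_D1 k G0).
have cG : #|G| = #|G :\ set0|.+1 by rewrite (cardsD1 set0) G0.
rewrite cG /= in lt_SG *.
apply: leq_trans (leq_add (num_chains_ge_missing0T hk _) (IHk _ _)).
(* Removing the empty set costs one term [(n + k.+1)./2 ^_ k]. The copies through the empty set make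
   up for it, since [#|G :\ set0|] is at least [Sigma n k], which [Sigma_step] compares with
   [Sigma n k.-1]. *)
- rewrite /= subSn // mulSn addnC leq_add2l.
  apply: leq_trans (_ : (if k == n then 1 else n) * (n + k)./2 ^_ k.-1 <= _).
    case: eqP => [->|ne_kn].
      have -> : (n + n.+1)./2 = n by lia.
      have -> : (n + n)./2 = n by lia.
      rewrite mul1n; case: (n) => // m; rewrite [in X in X <= _]ffactnSr /=.
      by rewrite subSnn muln1.
    (* The extra factor of the longer falling factorial is its last one if the two halves agree, and
       its first one otherwise; both are at most [n]. *)
    case: (eqVneq (n + k.+1)./2 (n + k)./2) => [-> | ne_t].
      have -> m : m ^_ k = m ^_ k.-1 * (m - k.-1) by rewrite -ffactnSr prednK.
      by rewrite mulnC leq_mul2r; apply/orP; right; lia.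
    have -> : (n + k.+1)./2 = (n + k)./2.+1 by lia.
    have -> m : m.+1 ^_ k = m.+1 * m ^_ k.-1 by rewrite -ffactSS prednK.
    by rewrite leq_mul2r; apply/orP; right; lia.
  rewrite leq_mul2r; apply/orP; right.
  have le_kn : 0 < k <= n by lia.
  by have := Sigma_step le_kn; lia.
- by rewrite !inE eqxx.
- by lia.
Qed.

End Flags.

(** * The upper bound for families inside [k] consecutive rows *)

Lemma leq_card_bigcup (I T : finType) (P : pred I) (S : I -> {set T}) :
  #|\bigcup_(i | P i) S i| <= \sum_(i | P i) #|S i|.
Proof.
elim/big_rec2: _ => [|i m X _ le_Xm]; first by rewrite cards0.
by apply: leq_trans (leq_card_setU _ _) _; rewrite leq_add2l.
Qed.

(** The [k + 1] members share a window of [k + 1] sizes, so these chains descend from [A] by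
    deleting one point at a time. *)
Definition down_chains (T : finType) k (A : {set T}) : {set {set {set T}}} :=
  [set C | [&& chain C, #|C| == k.+1, A \in C &
            [forall B in C, (B \subset A) && (#|A| <= #|B| + k)]]].

Lemma card_down_chains (T : finType) k (A : {set T}) :
  #|down_chains k A| <= #|A| ^_ k.
Proof.
elim: k A => [|k IHk] A.
  rewrite ffactn0 -(cards1 [set A]); apply/subset_leq_card/subsetP => C.
  rewrite !inE => /and4P[_ /cards1P[B ->] /set1P-> _]; exact: eqxx.
rewrite ffactnS -sum_nat_const.
apply: leq_trans (_ : \sum_(x in A) #|setU [set A] @: down_chains k (A :\ x)| <= _).
  apply: leq_trans (leq_card_bigcup _ _); apply/subset_leq_card/subsetP => C.
  rewrite inE => /and4P[hC /eqP cC inA /forall_inP hA].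
  have hC' : chain (C :\ A) by apply: chain_sub hC; apply: subD1set.
  have cC' : #|C :\ A| = k.+1 by move: cC; rewrite (cardsD1 A) inA => -[].
  have [|B /setD1P[neB inB] topB] := chain_topP hC'; first by rewrite -card_gt0 cC'.
  have /andP[sBA le_AB] := hA B inB.
  have pBA : B \proper A by rewrite properEneq neB.
  (* The remaining [k + 1] members have sizes from [#|A| - (k + 1)] to [#|B|], which forces
     [#|B| = #|A| - 1]. *)
  have : #|C :\ A| <= #|B|.+1 - (#|A| - k.+1).
    apply: chain_size_range => // D inD; rewrite subset_leq_card ?topB // andbT.
    by move/setD1P: inD => [_ /hA /andP[_]]; rewrite leq_subLR addnC.
  rewrite cC' => le_k; have lt_BA := proper_card pBA.
  have cAB : #|A :\: B| == 1 by rewrite cardsDS //; apply/eqP; lia.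
  case/cards1P: cAB => x defx.
  have inx : x \in A by have := set11 x; rewrite -defx inE => /andP[].
  have defB : A :\ x = B.
    by rewrite -defx setDDr setDv set0U; apply/setIidPr.
  apply/bigcupP; exists x => //; apply/imsetP; exists (C :\ A); last by rewrite setD1K.
  rewrite inE hC' cC' eqxx defB !inE neB inB /=; apply/forall_inP => D inD.
  rewrite topB //=; move/setD1P: inD => [_ /hA /andP[_ leD]]; lia.
apply: leq_sum => x inx; apply: leq_trans (leq_imset_card _ _) _.
by apply: leq_trans (IHk _) _; rewrite (cardsD1 x A) inx.
Qed.

Section Upper.

Variable n : nat.
Implicit Types (A B : {set 'I_n}) (C F X : {set {set 'I_n}}).

(** A copy of P_k in [k] consecutive rows has a member in each of them. Its top lies in row [t],
    hence in [X], and the rest is a descending chain below that top. *)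
Lemma num_chains_le k t F X : 0 < k ->
  (forall A, A \in F -> #|A| <= t <= #|A| + k.-1) ->
  (forall A, A \in F -> #|A| = t -> A \in X) -> (forall A, A \in X -> #|A| = t) ->
  num_chains k F <= #|X| * t ^_ k.-1.
Proof.
move=> k_gt0 hF hX Xt; rewrite num_chainsE -sum_nat_const.
apply: leq_trans (_ : \sum_(A in X) #|down_chains k.-1 A| <= _); last first.
  by apply: leq_sum => A /Xt <-; apply: card_down_chains.
apply: leq_trans (leq_card_bigcup _ _); apply/subset_leq_card/subsetP => C.
rewrite inE => /and3P[/subsetP sCF /eqP cC hC].
have [|A inA topA] := chain_topP hC; first by rewrite -card_gt0 cC.
have At : #|A| = t.
  have : #|C| <= #|A|.+1 - (t - k.-1).
    apply: chain_size_range => // D inD; rewrite subset_leq_card ?topA // andbT.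
    by have /andP[_] := hF D (sCF D inD); rewrite leq_subLR addnC.
  by rewrite cC; have := hF A (sCF A inA); lia.
apply/bigcupP; exists A; first by apply: hX => //; apply: sCF.
rewrite inE hC cC prednK // eqxx inA /=; apply/forall_inP => D inD.
by rewrite topA //= At; have /andP[_] := hF D (sCF D inD).
Qed.

Lemma num_chains_setC k F : num_chains k ((@setC _) @: F) = num_chains k F.
Proof.
suff le : forall G : {set {set 'I_n}}, num_chains k G <= num_chains k ((@setC _) @: G).
  by apply/eqP; rewrite eqn_leq le andbT -{2}[F]imset_setCK le.
move=> G; rewrite !num_chainsE.
rewrite -(card_imset _ (imset_inj (@setC_inj 'I_n))).
apply/subset_leq_card/subsetP => _ /imsetP[C + ->].
rewrite !inE => /and3P[sCG cC hC].
by rewrite card_imset_setC cC chain_setC // imsetS.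
Qed.

End Upper.

(** For [k > t] both sides vanish: the integer product has a zero factor at [i = t + 1]. *)
Lemma prod_ffact (t k : nat) :
  (\prod_(1 <= i < k.+1) (t%:Z - i%:Z + 1) = (t ^_ k)%:Z)%R.
Proof.
elim: k => [|k IHk]; first by rewrite big_geq.
rewrite big_nat_recr //= IHk ffactnSr.
case: (leqP k t) => [le_kt | lt_tk]; last by rewrite ffact_small // mul0r.
by rewrite PoszM; congr (_ * _)%R; lia.
Qed.

(** * The two bounds combined for middle rows *)

Local Open Scope ring_scope.

Theorem mainTheorem2 (n k x : nat) (hn : (0 < n)%N) (hk : (0 < k)%N)
    (hx : (x <= binz n ((n %/ 2)%N%:Z + (-1) ^+ k * (k %/ 2)%N%:Z))%N)
    (B1 B2 X F : {set {set 'I_n}})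
    (hB1 : is_middle (k - 1)%N B1) (hB2 : is_middle k B2)
    (hX : X \subset B2 :\: B1) (hXx : #|X| = x)
    (hF : F = B1 :|: X) :
  [/\ #|F| = (x + Sigma n (k - 1))%N,
      (num_chains k F)%:Z
        = x%:Z * \prod_(1 <= i < k) (((n + k) %/ 2)%N%:Z - i%:Z + 1)
    & forall G : {set {set 'I_n}}, #|G| = (x + Sigma n (k - 1))%N ->
        (num_chains k F <= num_chains k G)%N].
Proof.
have cF : #|F| = (x + Sigma n (k - 1))%N.
  rewrite hF cardsU (is_middle_card hB1) hXx [X in (_ - X)%N](_ : _ = 0)%N.
    by rewrite subn0 addnC.
  apply/eqP; rewrite cards_eq0 setI_eq0 disjoint_sym.
  by apply: (disjointWl hX); rewrite -setI_eq0 setIDAC setDIl setDv setI0.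
have sX A : A \in X -> (A \in B2) && (A \notin B1).
  by move/(subsetP hX); rewrite inE andbC.
pose t := ((n + k)./2)%N.
(* Either [X] lies in row [t], just above [B1], or this holds after taking complements. *)
have position : (forall A, A \in B1 -> #|A| < t <= #|A| + k.-1)%N
      /\ (forall A, A \in X -> #|A| = t)
    \/ (forall A, A \in B1 -> n - #|A| < t <= n - #|A| + k.-1)%N
      /\ (forall A, A \in X -> n - #|A| = t)%N.
  have row_n (A : {set 'I_n}) := card_set_ord A.
  (* Only [B1] leaves a choice if [n + k] is odd, and only [B2] if it is even; that choice decides
     on which side of [B1] the set family [X] lies. *)
  case: (boolP (odd (n + k))) => par.
    case: hB1 => e1; [left | right]; split => A.
    1, 3: by have := row_n A; rewrite e1 inE /t /ceil_half /floor_half; lia.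
    1, 2: by move/sX; have := row_n A; case: hB2 => ->;
      rewrite e1 !inE /t /ceil_half /floor_half; lia.
  case: hB2 => e2; [right | left]; split => A.
  1, 3: by have := row_n A; case: hB1 => ->; rewrite inE /t /ceil_half /floor_half; lia.
  1, 2: by move/sX; have := row_n A; case: hB1 => ->;
    rewrite e2 !inE /t /ceil_half /floor_half; lia.
have ub : (num_chains k F <= x * t ^_ k.-1)%N.
  case: position => -[hB1' hX'].
    rewrite -hXx; apply: num_chains_le => // A; rewrite hF inE => /orP[] inA //.
    - by have := hB1' A inA; lia.
    - by rewrite hX' // leqnn leq_addr.
    - by have := hB1' A inA; lia.
  rewrite -num_chains_setC -hXx -(card_imset_setC X).
  have cC (A : {set 'I_n}) : #|A| = (n - #|~: A|)%N.
    by have := cardsC A; rewrite card_ord; lia.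
  apply: num_chains_le => // A; rewrite !mem_imset_setC ?hF ?inE => inA.
  - rewrite cC; case/orP: inA => inA; first by case/andP: (hB1' _ inA) => /ltnW-> ->.
    by rewrite hX' // leqnn leq_addr.
  - by rewrite cC => At; case/orP: inA => // /hB1'; rewrite At ltnn.
  - by rewrite cC hX'.
have lb (G : {set {set 'I_n}}) : #|G| = (x + Sigma n (k - 1))%N -> (x * t ^_ k.-1 <= num_chains k G)%N.
  move=> cG; case: (leqP k n.+1) => [le_kn | lt_nk].
    have := @num_chains_ge n k G; rewrite cG subn1 addnK; apply.
    by rewrite hk.
  (* Here [k > n + 1], so [t > n]: no subset has size [t], and [X] is empty. *)
  suff -> : x = 0%N by [].
  rewrite -hXx; apply/eqP; rewrite cards_eq0; apply/set0Pn => -[A inA].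
  by have := card_set_ord A; case: position => -[_ /(_ A inA)]; rewrite /t; lia.
split => //; last by move=> G /lb; apply: leq_trans.
rewrite divn2 -/t -{2}(prednK hk) prod_ffact -PoszM; congr Posz.
by apply/eqP; rewrite eqn_leq ub lb.
Qed.
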